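(* Let the agents run BQ-CADMM (defined in the context) on a connected network with $n$ nodes and $m$ edges, with arbitrary data $r_1,\dots,r_n\in\mathbb{R}$, arbitrary fixed $\rho>0$, and $\bar r=\frac1n\sum_{i=1}^n r_i$. Then there exists a finite iteration $k_0>0$ such that for $k\ge k_0$ one of the following holds. (i) (Convergent case) All the quantized variable values converge to the same quantization value: there is $x_Q^*\in\Lambda_{\mathcal X}$ such that for all $k\ge k_0$ $$\mathcal{Q}_b(x_1^k)=\cdots=\mathcal{Q}_b(x_n^k)= x_Q^*,$$ and $$\left|x_Q^*-\mathcal{T}_{\mathcal X}(\bar r)\right|\le\left(1+4\rho\frac{m}{n}\right)\frac{\Delta}{2}.$$ (ii) (Cyclic case) The variable values cycle with a finite period $T\ge 2$, i.e., $x_i^k=x_i^{k+T}$ for all $i=1,\dots,n$ and all $k\ge k_0$. Furthermore, the sample average over one period reaches a consensus: for $k\ge k_0$, $$\frac1T\sum_{l=1}^{T}\mathcal{Q}_b\left(x_1^{k+l}\right)=\cdots=\frac1T\sum_{l=1}^{T}\mathcal{Q}_b\left(x_n^{k+l}\right)\triangleq\bar x_Q^*,$$ and $$\left|\bar x_Q^*-\bar r\right|\le\left(1+4\rho\frac{m}{n}\right)\Gamma_0,\qquad \Gamma_0\triangleq\max\left\{\frac{\Delta}{2},\frac{4\rho nL}{1+2\rho n}\right\}.$$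
   Context: Network: a connected, simple, undirected graph with node set $\{1,\dots,n\}$ and $m$ edges; $\mathcal{N}_i$ denotes the set of neighbors of node $i$ (not containing $i$) and $|\mathcal N_i|$ its cardinality. Quantizer: fix a resolution $\Delta>0$ and let $\Lambda=\{t\Delta:t\in\mathbb{Z}\}$. The rounding quantizer $\mathcal{Q}:\mathbb{R}\to\Lambda$ is $\mathcal{Q}(x)=t\Delta$ if $(t-\frac12)\Delta<x\le(t+\frac12)\Delta$. Let $\mathcal{X}=[-L,L]$ with $0<L<\infty$ a multiple of $\Delta$, let $\Lambda_{\mathcal X}=[-L,L]\cap\Lambda$, and let $\mathcal{T}_{\mathcal X}:\mathbb{R}\to\mathcal X$ be the projection mapping a real number to the nearest point of $\mathcal X$. The bounded quantizer is $\mathcal{Q}_b=\mathcal{Q}\circ\mathcal{T}_{\mathcal X}:\mathbb{R}\to\Lambda_{\mathcal X}$. BQ-CADMM: given data $r_i\in\mathbb{R}$ and a parameter $\rho>0$, initialize $x_i^0=0$ and $\alpha_i^0=0$ for $i=1,\dots,n$, and for $k=0,1,2,\dots$ and every $i$ set $$x_i^{k+1}=\frac{1}{1+2\rho|\mathcal N_i|}\Big(\rho|\mathcal N_i|\mathcal{Q}_b(x_i^k)+\rho\sum_{j\in\mathcal N_i}\mathcal{Q}_b(x_j^k)-\alpha_i^k+r_i\Big),$$ $$\alpha_i^{k+1}=\alpha_i^k+\rho\Big(|\mathcal N_i|\mathcal{Q}_b(x_i^{k+1})-\sum_{j\in\mathcal N_i}\mathcal{Q}_b(x_j^{k+1})\Big).$$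 The iteration is considered as running indefinitely. *)

(* Defs.v *)
From HB Require Import structures.
From mathcomp Require Import all_boot all_order all_algebra.
From mathcomp Require Import classical_sets reals.
From mathcomp Require Import ring lra.

Set Implicit Arguments.
Unset Strict Implicit.
Unset Printing Implicit Defensive.

Import Order.TTheory GRing.Theory Num.Theory.

Local Open Scope classical_set_scope.
Local Open Scope ring_scope.

Section Network.
Variables (n : nat) (e : rel 'I_n).

Definition simple_graph : Prop := symmetric e /\ irreflexive e.

Definition connected_graph : Prop := forall i j : 'I_n, connect e i j.

(* Undirected edges, each one being the unordered pair of its endpoints. *)
Definition edges : {set {set 'I_n}} :=
  [set [set p.1; p.2] | p : 'I_n * 'I_n & e p.1 p.2]%SET.

Definition neighbors (i : 'I_n) : {set 'I_n} := [set j | e i j]%SET.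

End Network.

Section Quantizer.
Variables (R : realType) (Delta L : R).

Definition lattice : set R := [set x | exists t : int, x = t%:~R * Delta].

Definition bounded_lattice : set R := [set x | - L <= x <= L] `&` lattice.

(* The ceiling rounds half-way points down; see [quantizerP]. *)
Definition quantizer (x : R) : R :=
  (Num.ceil (x / Delta - 2^-1))%:~R * Delta.

Lemma quantizerP (x : R) (t : int) : 0 < Delta ->
  (t%:~R - 2^-1) * Delta < x <= (t%:~R + 2^-1) * Delta ->
  quantizer x = t%:~R * Delta.
Proof.
move=> D0; rewrite -ltr_pdivlMr// -ler_pdivrMr// => /andP[tx xt].
rewrite /quantizer; congr (_%:~R * _); apply: ceil_def.
by rewrite intrD; apply/andP; split; lra.
Qed.

(* Projection onto [-L, L]; see [projection_nearest]. *)
Definition projection (x : R) : R := Num.max (- L) (Num.min L x).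

Lemma projection_nearest (x y : R) : 0 < L -> - L <= y <= L ->
  - L <= projection x <= L /\ `|x - projection x| <= `|x - y|.
Proof.
move=> L0 /andP[Ly yL]; rewrite /projection.
case: (lerP L x) => Lx.
  rewrite (@max_r _ _ (- L) L); last by lra.
  by split; [lra | rewrite !ger0_norm; lra].
case: (lerP (- L) x) => xL.
  by split; [lra | rewrite subrr normr0].
by split; [lra | rewrite !ltr0_norm; lra].
Qed.

Definition bounded_quantizer (x : R) : R := quantizer (projection x).

End Quantizer.

Section BQ_CADMM.
Variables (R : realType) (n : nat) (e : rel 'I_n) (Delta L rho : R).
Variable r : 'I_n -> R.

Local Notation Qb := (bounded_quantizer Delta L).
Local Notation deg i := (#|neighbors e i|%:R : R).

Definition bq_update_x (x alpha : 'I_n -> R) (i : 'I_n) : R :=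
  (1 + 2 * rho * deg i)^-1 *
  (rho * deg i * Qb (x i) + rho * (\sum_(j in neighbors e i) Qb (x j))
   - alpha i + r i).

Definition bq_update_alpha (x' alpha : 'I_n -> R) (i : 'I_n) : R :=
  alpha i + rho * (deg i * Qb (x' i) - \sum_(j in neighbors e i) Qb (x' j)).

(* The pair (x^k, alpha^k); the multiplier update uses the new x^{k+1}. *)
Fixpoint bq_iterate (k : nat) : ('I_n -> R) * ('I_n -> R) :=
  if k is k'.+1 then
    let: (x, alpha) := bq_iterate k' in
    let x' := bq_update_x x alpha in (x', bq_update_alpha x' alpha)
  else (fun=> 0, fun=> 0).

Definition bq_x (k : nat) : 'I_n -> R := (bq_iterate k).1.
Definition bq_alpha (k : nat) : 'I_n -> R := (bq_iterate k).2.

Lemma bq_xS k : bq_x k.+1 = bq_update_x (bq_x k) (bq_alpha k).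
Proof. by rewrite /bq_x /bq_alpha /=; case: bq_iterate. Qed.

Lemma bq_alphaS k :
  bq_alpha k.+1 = bq_update_alpha (bq_x k.+1) (bq_alpha k).
Proof. by rewrite /bq_x /bq_alpha /=; case: bq_iterate. Qed.

End BQ_CADMM.

Definition period_from (V : Type) (n : nat) (x : nat -> 'I_n -> V)
    (k0 T : nat) : Prop :=
  forall (k : nat) (i : 'I_n), (k0 <= k)%N -> x k i = x (k + T)%N i.

(* "The period" is the least positive one. Without minimality, T >= 2 would
   be no restriction: a constant sequence has every T as a period. *)
Definition cycles_with_period (V : Type) (n : nat) (x : nat -> 'I_n -> V)
    (k0 T : nat) : Prop :=
  period_from x k0 T /\
  forall T' : nat, (0 < T' < T)%N -> ~ period_from x k0 T'.

(* Main.v *)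
Require Import Defs.
From mathcomp Require Import all_boot all_order all_algebra.
From mathcomp Require Import boolp classical_sets reals.
From mathcomp Require Import ring lra zify.

Set Implicit Arguments.
Unset Strict Implicit.
Unset Printing Implicit Defensive.

Import Order.TTheory GRing.Theory Num.Theory.
Local Open Scope ring_scope.

(** The quantized values z_i^k range over a finite set, and every multiplier
    alpha_i^k is an integer multiple of rho Delta.  So if the multipliers stay
    bounded, the pair (z^k, alpha^k) takes finitely many values; it determines
    the whole future of the run, hence the run is eventually periodic.

    The multipliers are bounded because they can only grow in the direction in
    which they are corrected ([multiplier_step]).  Write d for the degree of a
    node.  When z_i = L, no neighbor is above node i, so r_i - alpha_i cannot
    increase.  When z_i <> L, the variable x_i exceeds z_i by at most Delta / 2,
    and the equation that produced x_i then bounds r_i - alpha_i by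
    L + 4 rho d L, whatever happened before.  Negating the run gives the
    lower bound.

    Take the least period T.  Over a period the multipliers return to their
    values, so the graph Laplacian of the summed quantized values is zero, and
    on a connected graph these sums agree ([window_consensus]).  The Laplacian
    has zero column sums, so the multipliers sum to zero over the nodes, and
    adding the equations for x over the nodes and over a period gives, with
    xbar_i for the time average of x_i, q for the common time average of the
    z_i and rbar for the mean of the data,
<<
      sum_i (1 + 2 rho d_i) (xbar_i - q) = n (rbar - q).
>>
    By the handshake lemma the weights add up to n + 4 rho m, so bounds on the
    individual errors x_i - z_i become the stated bounds on rbar - q
    ([mean_error_upper], [mean_error_lower]).

    If T = 1, every z_i is constantly q; the error is at most Delta / 2 on each
    side on which q is not saturated, and on a saturated side the projection of
    rbar cannot pass q.  If T >= 2, no node sits forever at L or at - L: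
    otherwise the consensus of averages would freeze every node there, and x
    would be constant.  Each node therefore leaves L at some time, which
    resets r_i - alpha_i below L + 4 rho d L for good, and with it the excess
    of x_i over L ([node_error_upper]); likewise at - L. *)
(** * The bounded quantizer *)

Section Lattice.
Variables (R : realType) (Delta : R).
Hypothesis Delta_gt0 : 0 < Delta.

Lemma lattice_opp z : lattice Delta z -> lattice Delta (- z).
Proof. by move=> [t ->]; exists (- t); rewrite mulrNz mulNr. Qed.

Lemma latticeD z w : lattice Delta z -> lattice Delta w -> lattice Delta (z + w).
Proof. by move=> [t ->] [u ->]; exists (t + u); rewrite intrD mulrDl. Qed.

Lemma lattice_natmul (d : nat) z : lattice Delta z -> lattice Delta (d%:R * z).
Proof. by move=> [t ->]; exists (d%:Z * t); rewrite intrM mulrA. Qed.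

Lemma lattice_sum (I : finType) (P : pred I) (z : I -> R) :
  (forall i, lattice Delta (z i)) -> lattice Delta (\sum_(i | P i) z i).
Proof.
move=> z_lat; elim/big_rec: _ => [|i y _ y_lat]; last exact: latticeD.
by exists 0; rewrite mul0r.
Qed.

Lemma lattice_gap z w :
  lattice Delta z -> lattice Delta w -> z < w -> z <= w - Delta.
Proof.
move=> [t ->] [u ->]; rewrite ltr_pM2r// ltr_int => tu.
rewrite -[X in _ - X]mul1r -mulrBl ler_pM2r// -[1]/(1%:~R) -intrB ler_int.
by move: tu; lia.
Qed.

(** Boundedness of a lattice-valued quantity gives finiteness in this form,
    which serves both the quantized values and the multipliers. *)
Lemma lattice_finite (B : R) :
  exists s : seq R, forall z, lattice Delta z -> `|z| <= B -> z \in s.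
Proof.
pose N := `|Num.ceil (B / Delta)|%N.
exists [seq (t%:Z - N%:Z)%:~R * Delta | t <- iota 0 (2 * N).+1].
move=> _ [t ->]; rewrite normrM (gtr0_norm Delta_gt0) -ler_pdivlMr// => tB.
have tN : `|t| <= N%:Z.
  have := le_trans tB (ceil_ge _); rewrite -intr_norm ler_int.
  by move/le_trans; apply; rewrite /N abszE ler_norm.
apply/mapP; exists (absz (t + N%:Z)); first by rewrite mem_iota; lia.
by congr (_%:~R * _); lia.
Qed.

Lemma quantizer_lattice z : lattice Delta z -> quantizer Delta z = z.
Proof. by move=> [t ->]; have D0 := Delta_gt0; apply: quantizerP => //; nra. Qed.

Lemma quantizer_is_lattice x : lattice Delta (quantizer Delta x).
Proof. by eexists. Qed.

Lemma quantizer_error x :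
  quantizer Delta x - Delta / 2 <= x <= quantizer Delta x + Delta / 2.
Proof.
have /andP[] := ceil_itv (x / Delta - 2^-1).
rewrite /quantizer intrB; set c := (Num.ceil _)%:~R => lo hi.
have xE : x = x / Delta * Delta by rewrite divfK// gt_eqF.
move: lo hi xE; move: (x / Delta) => u lo hi ->.
have -> : c * Delta - Delta / 2 = (c - 2^-1) * Delta by field.
have -> : c * Delta + Delta / 2 = (c + 2^-1) * Delta by field.
by rewrite !ler_pM2r//; apply/andP; split; lra.
Qed.

End Lattice.

Section Projection.
Variables (R : realType) (L : R).
Hypothesis L_gt0 : 0 < L.

Lemma projection_bounds x : - L <= projection L x <= L.
Proof.
have L0 : - L <= 0 <= L by have := L_gt0; lra.
by have [] := projection_nearest x L_gt0 L0.
Qed.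

Lemma projection_ge x : x <= L -> x <= projection L x.
Proof. by move=> xL; rewrite /projection le_max le_min xL lexx orbT. Qed.

Lemma projection_le x : - L <= x -> projection L x <= x.
Proof. by move=> xL; rewrite /projection ge_max ge_min xL lexx orbT. Qed.

(** At q = L the projection of y cannot exceed q, so no upper control of y is
    needed; symmetrically at q = - L. *)
Lemma projection_dist q y g : - L <= q <= L -> 0 <= g ->
  q = L \/ y - q <= g -> q = - L \/ q - y <= g -> `|q - projection L y| <= g.
Proof.
move=> /andP[Lq qL] g0 hi lo; have /andP[Lp pL] := projection_bounds y.
rewrite ler_distl; apply/andP; split.
  case: hi => [->|hi]; first by lra.
  have [yL|/ltW Ly] := leP (- L) y; first by have := projection_le yL; lra.
  suff -> : projection L y = - L by lra.
  by rewrite /projection max_l// ge_min Ly orbT.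
case: lo => [->|lo]; first by lra.
have [yL|/ltW Ly] := leP y L; first by have := projection_ge yL; lra.
suff -> : projection L y = L by lra.
by rewrite /projection (min_l Ly) max_r//; lra.
Qed.

End Projection.

Section BoundedQuantizer.
Variables (R : realType) (Delta L : R).
Hypotheses (Delta_gt0 : 0 < Delta) (L_gt0 : 0 < L) (L_lattice : lattice Delta L).

Lemma bounded_quantizer_in x :
  bounded_lattice Delta L (bounded_quantizer Delta L x).
Proof.
have D0 := Delta_gt0.
split; last exact: quantizer_is_lattice; rewrite /mkset /bounded_quantizer.
have /andP[Lp pL] := projection_bounds L_gt0 x.
have /andP[lo hi] := quantizer_error Delta_gt0 (projection L x).
have q_lat := quantizer_is_lattice Delta (projection L x).
apply/andP; split; rewrite leNgt; apply/negP => out.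
  by have := lattice_gap Delta_gt0 q_lat (lattice_opp L_lattice) out; lra.
by have := lattice_gap Delta_gt0 L_lattice q_lat out; lra.
Qed.

(** Saturation at L is the only way for x to exceed its quantized value by more
    than half a cell.  The full cell that separates the other values from L
    absorbs this half-cell error in the bound on the multipliers. *)
Lemma bounded_quantizer_upper x :
  bounded_quantizer Delta L x = L \/
  bounded_quantizer Delta L x <= L - Delta /\
  x <= bounded_quantizer Delta L x + Delta / 2.
Proof.
have [/andP[_ qL] q_lat] := bounded_quantizer_in x.
have [->|qNL] := eqVneq (bounded_quantizer Delta L x) L; [by left|right].
split; first by apply: lattice_gap => //; rewrite lt_neqAle qNL qL.
have /andP[_ hi] := quantizer_error Delta_gt0 (projection L x).
apply: le_trans hi; apply: projection_ge; rewrite leNgt; apply/negP => Lx.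
case/eqP: qNL; rewrite /bounded_quantizer.
suff -> : projection L x = L by apply: quantizer_lattice.
by rewrite /projection (min_l (ltW Lx)) max_r//; have := L_gt0; lra.
Qed.

Lemma bounded_quantizer_lower x :
  bounded_quantizer Delta L x = - L \/
  - L + Delta <= bounded_quantizer Delta L x /\
  bounded_quantizer Delta L x - Delta / 2 <= x.
Proof.
have [/andP[Lq _] q_lat] := bounded_quantizer_in x.
have [->|qNL] := eqVneq (bounded_quantizer Delta L x) (- L); [by left|right].
split.
  suff: - L <= bounded_quantizer Delta L x - Delta by lra.
  apply: lattice_gap => //; first exact: lattice_opp.
  by rewrite lt_neqAle eq_sym qNL Lq.
have /andP[lo _] := quantizer_error Delta_gt0 (projection L x).
apply: le_trans lo _; apply: projection_le; rewrite leNgt; apply/negP => Lx.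
case/eqP: qNL; rewrite /bounded_quantizer.
suff -> : projection L x = - L by apply/quantizer_lattice/lattice_opp.
by rewrite /projection max_l// ge_min (ltW Lx) orbT.
Qed.

End BoundedQuantizer.

(** * Graphs *)

Section Graph.
Variables (n : nat) (e : rel 'I_n).
Hypothesis e_simple : simple_graph e.

(** Both sides count the ordered pairs of adjacent nodes: an edge {i, j} comes
    from exactly the two pairs (i, j) and (j, i), distinct as there are no
    loops. *)
Lemma handshake :
  (\sum_(i < n) #|neighbors e i| = 2 * #|edges e|)%N.
Proof.
have [e_sym e_irr] := e_simple.
pose D := [set p : 'I_n * 'I_n | e p.1 p.2].
have -> : (\sum_(i < n) #|neighbors e i| = #|D|)%N.
  rewrite -sum1_card (eq_bigl (fun p => e p.1 p.2)) => [|p]; last by rewrite inE.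
  rewrite -(pair_big_dep predT e (fun _ _ => 1%N))/=.
  by apply: eq_bigr => i _; rewrite -sum1_card; apply: eq_bigl => j; rewrite inE.
have edgesE : edges e = [set [set p.1; p.2] | p in D].
  by apply/setP => A; apply/imsetP/imsetP => -[p]; rewrite ?inE => pe ->;
    exists p; rewrite ?inE.
have D_edges p : p \in D -> [set p.1; p.2] \in edges e.
  by move=> pD; rewrite edgesE; apply: imset_f.
rewrite -sum1_card (partition_big (fun p => [set p.1; p.2]) (mem (edges e)))//=.
rewrite mulnC -sum_nat_const; apply: eq_bigr => A.
rewrite edgesE => /imsetP[[i j]]; rewrite inE /= => eij ->.
have iNj : i != j by apply: contraTneq eij => ->; rewrite e_irr.
rewrite sum1dep_card (_ : [set _ | _] = [set (i, j); (j, i)]).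
  by rewrite cards2 xpair_eqE (negbTE iNj).
apply/setP => -[k l]; rewrite !inE !xpair_eqE /=; apply/andP/orP.
  case=> ekl /eqP kl.
  have kNl : k != l by apply: contraTneq ekl => ->; rewrite e_irr.
  have : k \in [set i; j] by rewrite -kl !inE eqxx.
  have : l \in [set i; j] by rewrite -kl !inE eqxx orbT.
  rewrite !inE => /orP[]/eqP lE /orP[]/eqP kE; subst k l;
    rewrite ?eqxx in kNl *; by [|left|right].
by case=> /andP[/eqP-> /eqP->]; rewrite ?(e_sym j) eij ?eqxx// finset.setUC.
Qed.

(** Maximum principle: where y is maximal, it equals the mean of values that are
    no larger, so all neighbors are maximal too, and maximality spreads along
    paths. *)
Lemma harmonic_constant (R : realType) (y : 'I_n -> R) :
  connected_graph e ->
  (forall i, #|neighbors e i|%:R * y i = \sum_(j in neighbors e i) y j) ->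
  forall i j, y i = y j.
Proof.
move=> e_conn harm i0.
pose top := [arg max_(i > i0) y i]%O.
have y_le j : y j <= y top by rewrite /top; case: arg_maxP => // ? _; apply.
have step i j : y i = y top -> e i j -> y j = y top.
  move=> yi eij; apply/eqP; rewrite eq_sym -subr_eq0; apply/eqP.
  apply: (@psumr_eq0P R _ (mem (neighbors e i)) (fun j => y top - y j)).
  - by move=> l _; rewrite subr_ge0.
  - by rewrite sumrB -harm yi sumr_const mulr_natl subrr.
  - by rewrite !inE.
have along p : forall i, y i = y top -> path e i p -> y (last i p) = y top.
  elim: p => //= l p IH i yi /andP[eil].
  by apply: IH; apply: step eil.
have all_top j : y j = y top.
  by have /connectP[p pe ->] := e_conn top j; apply: along.
by move=> j; rewrite !all_top.
Qed.

Lemma sum_neighbors_swap (R : realType) (y : 'I_n -> R) :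
  \sum_i \sum_(j in neighbors e i) y j = \sum_i #|neighbors e i|%:R * y i.
Proof.
rewrite (exchange_big_dep predT)//=; apply: eq_bigr => j _.
rewrite (eq_bigl (mem (neighbors e j))) => [|i].
  by rewrite sumr_const mulr_natl.
by rewrite !inE; case: e_simple => ->.
Qed.

End Graph.

(** * A single node *)

(** What a single node sees: a k stands for the sum of the quantized values of
    its d neighbors.  The quantizer rounds half-way points down and so does not
    commute with negation; only the weak inequalities that hold on both sides
    are kept, which makes the notion invariant under negation. *)
Record node_run (R : realType) (Delta L rho d r : R) (x z a al : nat -> R) : Prop :=
  NodeRun {
    node_x : forall k,
      (1 + 2 * rho * d) * x k.+1 = rho * (d * z k + a k) - al k + r;
    node_al : forall k, al k.+1 = al k + rho * (d * z k.+1 - a k.+1);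
    node_z : forall k, - L <= z k <= L;
    node_a : forall k, - (d * L) <= a k <= d * L;
    node_upper : forall k,
      z k = L \/ z k <= L - Delta /\ x k <= z k + Delta / 2;
    node_lower : forall k,
      z k = - L \/ - L + Delta <= z k /\ z k - Delta / 2 <= x k }.

Lemma node_run_opp (R : realType) (Delta L rho d r : R) (x z a al : nat -> R) :
  node_run Delta L rho d r x z a al ->
  node_run Delta L rho d (- r) (fun k => - x k) (fun k => - z k)
    (fun k => - a k) (fun k => - al k).
Proof.
case=> xE alE zL aL up lo; split=> k.
- by rewrite mulrN xE; ring.
- by rewrite alE; ring.
- by have := zL k; lra.
- by have := aL k; lra.
- by case: (lo k) => [->|[]]; [left; ring | right; split; lra].
- by case: (up k) => [->|[]]; [left | right; split; lra].
Qed.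

(** A node at L is at least as high as each neighbor, so its multiplier does not
    decrease.  A node below L has x <= z + Delta / 2, and the equation for x
    bounds r - al by a constant that forgets the past. *)
Lemma multiplier_step (R : realType) (Delta L rho d r : R) (x z a al : nat -> R) k :
  0 < Delta -> 0 < rho -> 0 <= d -> node_run Delta L rho d r x z a al ->
  (z k.+1 = L /\ r - al k.+1 <= r - al k) \/
  r - al k.+1 <= L + 4 * rho * d * L.
Proof.
move=> D0 rho0 d0 run; have alE := node_al run k.
have /andP[a1l a1u] := node_a run k.+1.
case: (node_upper run k.+1) => [zL|[zL xz]]; [left | right].
  have : 0 <= rho * (d * L - a k.+1) by apply: mulr_ge0; lra.
  by rewrite alE zL; split=> //; lra.
have rd0 : 0 <= rho * d by apply: mulr_ge0; lra.
have /andP[zl zu] := node_z run k; have /andP[al0 au0] := node_a run k.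
have xE := node_x run k.
(* The inequalities below, added up, give L + 4 rho d L - Delta / 2: in the sum
   z k.+1 has weight (1 + 2 rho d) - rho d = 1 + rho d, and its gap of Delta
   to L outweighs the rounding error (1 + 2 rho d) Delta / 2. *)
have h1 : 0 <= (1 + 2 * rho * d) * (z k.+1 + Delta / 2 - x k.+1).
  by apply: mulr_ge0; lra.
have h2 : 0 <= rho * d * (z k + L) by apply: mulr_ge0; lra.
have h3 : 0 <= rho * (a k + d * L) by apply: mulr_ge0; lra.
have h4 : 0 <= rho * (d * L - a k.+1) by apply: mulr_ge0; lra.
have h5 : 0 <= (1 + rho * d) * (L - Delta - z k.+1) by apply: mulr_ge0; lra.
by rewrite alE; lra.
Qed.

Lemma multiplier_bound (R : realType) (Delta L rho d r B : R)
    (x z a al : nat -> R) k0 k :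
  0 < Delta -> 0 < rho -> 0 <= d -> node_run Delta L rho d r x z a al ->
  L + 4 * rho * d * L <= B -> r - al k0 <= B -> (k0 <= k)%N ->
  r - al k <= B.
Proof.
move=> D0 rho0 d0 run LB B0 /subnKC <-.
elim: (k - k0)%N => [|l IH]; first by rewrite addn0.
rewrite addnS; case: (multiplier_step (k0 + l) D0 rho0 d0 run) => [[_]|];
  by move/le_trans; apply.
Qed.

(** Once the node has been below L, r - al never again exceeds L + 4 rho d L;
    the neighbors and the node itself contribute at most 2 rho d L more, so
    (1 + 2 rho d) (x - L) <= 4 rho d L. *)
Lemma node_error_upper (R : realType) (Delta L rho d r : R)
    (x z a al : nat -> R) k0 k :
  0 < Delta -> 0 < rho -> 0 <= d -> node_run Delta L rho d r x z a al ->
  z k0.+1 != L -> (k0.+1 < k)%N ->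
  x k - z k <= Num.max (Delta / 2) (4 * rho * d * L / (1 + 2 * rho * d)).
Proof.
move=> D0 rho0 d0 run zNL; case: k => // k; rewrite ltnS => k0k.
rewrite le_max; case: (node_upper run k.+1) => [zL|[_ xz]]; last first.
  by apply/orP; left; lra.
apply/orP; right.
have rd0 : 0 <= rho * d by apply: mulr_ge0; lra.
have reset : r - al k0.+1 <= L + 4 * rho * d * L.
  by case: (multiplier_step k0 D0 rho0 d0 run) => // -[/eqP]; rewrite (negbTE zNL).
have bound := multiplier_bound D0 rho0 d0 run (lexx _) reset k0k.
rewrite ler_pdivlMr; last by lra.
have xE := node_x run k; have /andP[_ zu] := node_z run k.
have /andP[_ au] := node_a run k.
have h1 : 0 <= rho * d * (L - z k) by apply: mulr_ge0; lra.
have h2 : 0 <= rho * (d * L - a k) by apply: mulr_ge0; lra.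
by rewrite zL; lra.
Qed.

Lemma node_error_lower (R : realType) (Delta L rho d r : R)
    (x z a al : nat -> R) k0 k :
  0 < Delta -> 0 < rho -> 0 <= d -> node_run Delta L rho d r x z a al ->
  z k0.+1 != - L -> (k0.+1 < k)%N ->
  - Num.max (Delta / 2) (4 * rho * d * L / (1 + 2 * rho * d)) <= x k - z k.
Proof.
move=> D0 rho0 d0 run zNL k0k.
have := node_error_upper D0 rho0 d0 (node_run_opp run) (k0 := k0) (k := k).
by rewrite eqr_oppLR => /(_ zNL k0k); lra.
Qed.

(** * Recurrence *)

(** Pigeonhole on the positions in s of the values of f k. *)
Lemma finite_range_revisit (I : finType) (V : eqType) (s : seq V)
    (f : nat -> I -> V) :
  (forall k i, f k i \in s) ->
  exists k T, (0 < T)%N /\ f k =1 f (k + T)%N.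
Proof.
move=> fs.
pose code k := [ffun i => (inord (index (f k i) s) : 'I_(size s).+1)].
have code_inj k l : code k = code l -> f k =1 f l.
  move=> kl i; have := congr1 (fun c : {ffun I -> _} => val (c i)) kl.
  rewrite /= !ffunE !inordK ?ltnS ?index_size// => kli.
  by rewrite -(nth_index (f k i) (fs k i)) kli nth_index.
pose K := #|{ffun I -> 'I_(size s).+1}|.
have /injectivePn[k [l kNl kl]] :
    ~~ injectiveb (fun k : 'I_K.+1 => code k).
  by apply/negP => /injectiveP /leq_card; rewrite card_ord ltnn.
wlog kl_lt : k l kNl kl / (k < l)%N => [hw|].
  case: (ltngtP k l) => [|lk|/val_inj kE]; first exact: hw.
    by apply: (hw l k) => //; rewrite eq_sym.
  by rewrite kE eqxx in kNl.
exists k, (l - k)%N; split; first by rewrite subn_gt0.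
by rewrite subnKC ?(ltnW kl_lt)//; apply: code_inj.
Qed.

Lemma minimal_period (V : Type) (n : nat) (x : nat -> 'I_n -> V) k0 T :
  (0 < T)%N -> period_from x k0 T ->
  exists2 T', (0 < T')%N & cycles_with_period x k0 T'.
Proof.
move=> T0 xT.
have [|T' /andP[T'0 /asboolP xT'] T'min] :=
  ex_minnP (P := fun T => (0 < T)%N && `[< period_from x k0 T >]).
  by exists T; rewrite T0; apply/asboolP.
exists T' => //; split=> // U /andP[U0 UT'] xU.
have /T'min : (0 < U)%N && `[< period_from x k0 U >].
  by rewrite U0; apply/asboolP.
by rewrite leqNgt UT'.
Qed.

(** * The network *)

Section Run.
Variables (R : realType) (n : nat) (e : rel 'I_n) (Delta L rho : R) (r : 'I_n -> R).
Hypotheses (e_simple : simple_graph e) (e_connected : connected_graph e).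
Hypotheses (Delta_gt0 : 0 < Delta) (L_gt0 : 0 < L) (L_lattice : lattice Delta L).
Hypothesis (rho_gt0 : 0 < rho).

Local Notation d i := (#|neighbors e i|%:R : R).
Local Notation x := (bq_x e Delta L rho r).
Local Notation alpha := (bq_alpha e Delta L rho r).
Local Notation z k i := (bounded_quantizer Delta L (x k i)).
Local Notation a k i := (\sum_(j in neighbors e i) z k j).

Lemma degree_weight_gt0 i : 0 < 1 + 2 * rho * d i.
Proof. by rewrite ltr_wpDr// !mulr_ge0// (ltW rho_gt0). Qed.

Lemma bq_x_balance k i :
  (1 + 2 * rho * d i) * x k.+1 i = rho * (d i * z k i + a k i) - alpha k i + r i.
Proof.
rewrite bq_xS /bq_update_x mulrA mulfV ?gt_eqF ?degree_weight_gt0//.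
by rewrite mul1r; ring.
Qed.

Lemma bq_node_run i :
  node_run Delta L rho (d i) (r i) (x ^~ i) (fun k => z k i) (fun k => a k i)
    (alpha ^~ i).
Proof.
have zL k j : - L <= z k j <= L.
  by have [] := bounded_quantizer_in Delta_gt0 L_gt0 L_lattice (x k j).
split=> k; rewrite ?bq_x_balance ?bq_alphaS//.
- have dE y : d i * y = \sum_(j in neighbors e i) y by rewrite sumr_const mulr_natl.
  rewrite -mulrN !dE; apply/andP; split; apply: ler_sum => j _;
    by case/andP: (zL k j).
- exact: bounded_quantizer_upper.
- exact: bounded_quantizer_lower.
Qed.

Lemma degree_le i : d i <= n%:R.
Proof. by rewrite ler_nat -[X in (_ <= X)%N](card_ord n) max_card. Qed.

(** The bound on r - alpha must also cover its initial value r, which is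
    arbitrary. *)
Lemma alpha_bounded : exists B, forall k i, `|alpha k i| <= B.
Proof.
have rho0 := rho_gt0; have L0 := L_gt0.
pose B := \sum_i `|r i| + L + 4 * rho * n%:R * L.
have rB i : `|r i| <= \sum_i `|r i|.
  by rewrite (bigD1 i)//= lerDl sumr_ge0.
have nL : 0 <= 4 * rho * n%:R * L by rewrite !mulr_ge0// (ltW rho_gt0, ltW L_gt0).
have LB i : L + 4 * rho * d i * L <= B.
  have : 4 * rho * d i * L <= 4 * rho * n%:R * L.
    by rewrite ler_pM2r// ler_pM2l ?degree_le// mulr_gt0.
  by have := rB i; have := normr_ge0 (r i); rewrite /B; lra.
exists (B + B) => k i.
have a0 : alpha 0 i = 0 by [].
have rBi : `|r i| <= B by have := rB i; rewrite /B; lra.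
have up : r i - alpha k i <= B.
  apply: (multiplier_bound Delta_gt0 rho_gt0 _ (bq_node_run i) (LB i) _ (leq0n k)).
    exact: ler0n.
  by rewrite a0 subr0; have := ler_norm (r i); lra.
have lo : - r i - - alpha k i <= B.
  apply: (multiplier_bound Delta_gt0 rho_gt0 _ (node_run_opp (bq_node_run i))
            (LB i) _ (leq0n k)).
    exact: ler0n.
  by rewrite a0 oppr0 subr0; have := ler_norm (- r i); rewrite normrN; lra.
by move: rBi; rewrite !ler_norml; lra.
Qed.

Lemma alpha_lattice k i : lattice (rho * Delta) (alpha k i).
Proof.
elim: k => [|k IH]; first by exists 0; rewrite mul0r.
rewrite bq_alphaS; apply: latticeD => //.
suff [t ->] : lattice Delta (d i * z k.+1 i - a k.+1 i) by exists t; ring.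
apply: latticeD; first by apply: lattice_natmul; exact: quantizer_is_lattice.
by apply: lattice_opp; apply: lattice_sum => j; exact: quantizer_is_lattice.
Qed.

(** The update of x uses the old x only through its quantization, which is why a
    finite amount of information determines the run. *)
Lemma state_determines_future k k' :
  (forall i, z k i = z k' i) -> alpha k =1 alpha k' ->
  forall l i, x (k + l).+1 i = x (k' + l).+1 i.
Proof.
move=> zk ak l.
suff [zl al] : (forall i, z (k + l)%N i = z (k' + l)%N i) /\
    alpha (k + l) =1 alpha (k' + l).
  move=> i; rewrite !bq_xS /bq_update_x zl al.
  by under eq_bigr do rewrite zl.
elim: l => [|l [zl al]]; first by rewrite !addn0.
have xl i : x (k + l).+1 i = x (k' + l).+1 i.
  by rewrite !bq_xS /bq_update_x zl al; under eq_bigr do rewrite zl.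
rewrite !addnS; split=> i; rewrite ?xl// !bq_alphaS /bq_update_alpha al xl.
by under eq_bigr do rewrite xl.
Qed.

(** The pair (z, alpha) recurs from time k on, but x itself only from k + 1 on:
    x k is not determined by its quantization. *)
Lemma bq_x_eventually_periodic :
  exists k T, (0 < T)%N /\ period_from x k.+1 T.
Proof.
have [B aB] := alpha_bounded.
have [s1 s1P] := lattice_finite Delta_gt0 L.
have [s2 s2P] := lattice_finite (mulr_gt0 rho_gt0 Delta_gt0) B.
have [|k [T [T0 kT]]] := @finite_range_revisit _ _ [seq (p, q) | p <- s1, q <- s2]
  (fun k i => (z k i, alpha k i)).
  move=> k i; apply: allpairs_f.
    have [zL zl] := bounded_quantizer_in Delta_gt0 L_gt0 L_lattice (x k i).
    by apply: s1P => //; rewrite ler_norml.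
  by apply: s2P; [exact: alpha_lattice | exact: aB].
exists k, T; split=> // l i kl.
have zT j : z k j = z (k + T)%N j by case: (kT j).
have aT : alpha k =1 alpha (k + T) by move=> j; case: (kT j).
have := state_determines_future zT aT (l - k.+1) i.
have -> : (k + (l - k.+1)).+1 = l by lia.
by have -> : (k + T + (l - k.+1)).+1 = (l + T)%N by lia.
Qed.

(** * Averages over a period *)

(** The multiplier can be read off from x k and x k.+1, so every period of x is
    a period of alpha. *)
Lemma alpha_periodic k0 T : period_from x k0 T ->
  forall k i, (k0 <= k)%N -> alpha k i = alpha (k + T) i.
Proof.
move=> xT k i kk0.
have := bq_x_balance k i; have := bq_x_balance (k + T) i.
rewrite -addSn -(xT k.+1 i (leqW kk0)) -(xT k i kk0) => ->.
have -> : a (k + T)%N i = a k i by apply: eq_bigr => j _; rewrite -xT.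
by move=> /(congr1 (fun y => rho * (d i * z k i + a k i) + r i - y)); lra.
Qed.

Local Notation window T k i := (\sum_(1 <= l < T.+1) z (k + l)%N i).

Lemma window_shift k0 T : period_from x k0 T ->
  forall k i, (k0 <= k)%N -> window T k.+1 i = window T k i.
Proof.
move=> xT k i kk0; apply/eqP; rewrite -subr_eq0 -sumrB.
rewrite (@telescope_sumr_eq _ _ _ (fun l => z (k + l)%N i))// => [|l _].
  rewrite addn1 addnS -addSn -(xT k.+1 i (leqW kk0)).
  by rewrite subrr.
by rewrite addnS addSn.
Qed.

Lemma window_const k0 T : period_from x k0 T ->
  forall k i, (k0 <= k)%N -> window T k i = window T k0 i.
Proof.
move=> xT k i /subnKC <-; elim: (k - k0)%N => [|l IH]; first by rewrite addn0.
by rewrite addnS (window_shift xT) ?leq_addr.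
Qed.

(** The change of alpha over a period is rho times the Laplacian of the window
    sums; it vanishes, so the window sums are harmonic. *)
Lemma window_consensus k0 T : period_from x k0 T ->
  forall i j, window T k0 i = window T k0 j.
Proof.
move=> xT; apply: (harmonic_constant e_connected) => i.
apply/eqP; rewrite -subr_eq0 -(mulrI_eq0 _ (mulfI (lt0r_neq0 rho_gt0))).
rewrite exchange_big/= mulr_sumr -sumrB mulr_sumr.
rewrite (@telescope_sumr_eq _ _ _ (fun l => alpha (k0 + l).-1 i))// => [|l /andP[l0 _]].
  by rewrite addn1 addnS/= -(alpha_periodic xT) ?subrr.
by case: l l0 => // l _; rewrite !addnS/= bq_alphaS /bq_update_alpha [RHS]addrC addKr.
Qed.

(** The increments of alpha lie in the image of the graph Laplacian, whose
    columns sum to zero. *)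
Lemma sum_alpha k : \sum_i alpha k i = 0.
Proof.
elim: k => [|k IH]; first by rewrite big1.
rewrite bq_alphaS big_split/= IH add0r -mulr_sumr sumrB.
by rewrite (sum_neighbors_swap e_simple) subrr mulr0.
Qed.

Lemma sum_balance k :
  \sum_i (1 + 2 * rho * d i) * x k.+1 i
  = 2 * rho * \sum_i d i * z k i + \sum_i r i.
Proof.
under eq_bigr do rewrite bq_x_balance.
rewrite !big_split/= sumrN sum_alpha subr0 -mulr_sumr big_split/=.
by rewrite (sum_neighbors_swap e_simple); ring.
Qed.

(** Summing [sum_balance] over a period: the windows of x on the left and of z on
    the right are one step apart, which does not matter by periodicity, and
    consensus turns 2 rho sum_j d_j z_j into a multiple of the common window. *)
Lemma window_error_identity k0 T k i : period_from x k0 T -> (k0 <= k)%N ->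
  \sum_j (1 + 2 * rho * d j) *
     (\sum_(1 <= l < T.+1) (x (k.+1 + l)%N j - z (k.+1 + l)%N j))
  = T%:R * \sum_j r j - n%:R * window T k0 i.
Proof.
move=> xT kk0.
have W j : window T k.+1 j = window T k0 i.
  by rewrite (window_const xT _ (leqW kk0)); apply: window_consensus.
under eq_bigr do rewrite sumrB W mulrBr mulr_sumr.
rewrite sumrB exchange_big/=.
under eq_bigr do rewrite addSn sum_balance.
rewrite big_split/= sumr_const_nat subSS subn0 -mulr_sumr exchange_big/=.
have -> : \sum_j \sum_(1 <= l < T.+1) d j * z (k + l)%N j
    = \sum_j d j * window T k0 i.
  apply: eq_bigr => j _; rewrite -mulr_sumr (window_const xT _ kk0).
  by rewrite (window_consensus xT j i).
rewrite -!mulr_suml big_split/= sumr_const card_ord -mulr_sumr.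
by rewrite -[_ *+ T]mulr_natl; ring.
Qed.

Lemma sum_weights : \sum_i (1 + 2 * rho * d i) = n%:R + 4 * rho * #|edges e|%:R.
Proof.
rewrite big_split/= sumr_const card_ord -mulr_sumr -natr_sum (handshake e_simple).
by rewrite natrM; ring.
Qed.

Lemma mean_error_identity k0 T k i : (0 < n)%N -> (0 < T)%N ->
  period_from x k0 T -> (k0 <= k)%N ->
  n%:R^-1 * \sum_j r j - T%:R^-1 * window T k0 i
    = (T%:R * n%:R)^-1 * \sum_j (1 + 2 * rho * d j) *
        (\sum_(1 <= l < T.+1) (x (k.+1 + l)%N j - z (k.+1 + l)%N j)).
Proof.
move=> n0 T0 xT kk0; rewrite (window_error_identity i xT kk0).
by field; rewrite !pnatr_eq0 -!lt0n n0.
Qed.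

(** The weights 1 + 2 rho d_j sum to n + 4 rho m. *)
Lemma weighted_mean_le T (w : nat -> 'I_n -> R) g : (0 < n)%N -> (0 < T)%N ->
  (forall l j, w l j <= g) ->
  (T%:R * n%:R)^-1 *
    \sum_j (1 + 2 * rho * d j) * (\sum_(1 <= l < T.+1) w l j)
    <= (1 + 4 * rho * (#|edges e|%:R / n%:R)) * g.
Proof.
move=> n0 T0 wg.
have Tn0 : 0 < T%:R * n%:R :> R by rewrite -natrM ltr0n muln_gt0 T0.
rewrite ler_pdivrMl//.
have -> : T%:R * n%:R * ((1 + 4 * rho * (#|edges e|%:R / n%:R)) * g)
    = \sum_j (1 + 2 * rho * d j) * (\sum_(1 <= l < T.+1) g).
  rewrite -mulr_suml sum_weights sumr_const_nat subSS subn0 -[g *+ T]mulr_natl.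
  by field; rewrite pnatr_eq0 -lt0n.
apply: ler_sum => j _; rewrite ler_pM2l ?degree_weight_gt0//.
exact: ler_sum.
Qed.

Lemma mean_error_upper k0 T k i g : (0 < n)%N -> (0 < T)%N ->
  period_from x k0 T -> (k0 <= k)%N ->
  (forall l j, (k < l)%N -> x l j - z l j <= g) ->
  n%:R^-1 * \sum_j r j - T%:R^-1 * window T k0 i
    <= (1 + 4 * rho * (#|edges e|%:R / n%:R)) * g.
Proof.
move=> n0 T0 xT kk0 xz; rewrite (mean_error_identity i n0 T0 xT kk0).
by apply: weighted_mean_le => // l j; apply: xz; rewrite addSn ltnS leq_addr.
Qed.

Lemma mean_error_lower k0 T k i g : (0 < n)%N -> (0 < T)%N ->
  period_from x k0 T -> (k0 <= k)%N ->
  (forall l j, (k < l)%N -> z l j - x l j <= g) ->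
  T%:R^-1 * window T k0 i - n%:R^-1 * \sum_j r j
    <= (1 + 4 * rho * (#|edges e|%:R / n%:R)) * g.
Proof.
move=> n0 T0 xT kk0 xz; rewrite -opprB (mean_error_identity i n0 T0 xT kk0).
rewrite -mulrN -sumrN; under eq_bigr do rewrite -mulrN -sumrN.
apply: weighted_mean_le => // l j; rewrite opprB.
by apply: xz; rewrite addSn ltnS leq_addr.
Qed.

(** * The two regimes *)

(** An average of values in [-L, L] is extreme only if all of them are, and all
    nodes have the same average. *)
Lemma window_extreme k0 T q i : (0 < T)%N -> period_from x k0 T -> `|q| = L ->
  (forall k, (k0 <= k)%N -> z k.+1 i = q) ->
  forall k j, (k0 <= k)%N -> z k.+1 j = q.
Proof.
move=> T0 xT qL zi k j kk0.
have q_neq0 : q != 0 by rewrite -normr_gt0 qL.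
(* The factor q treats q = L and q = - L at once. *)
have term l : 0 <= q * (q - z l j).
  have [/andP[Lz zL] _] := bounded_quantizer_in Delta_gt0 L_gt0 L_lattice (x l j).
  by case: (ger0P q) qL => _ qL; rewrite -?qL in Lz zL *; nra.
have sum0 : \sum_(1 <= l < T.+1) q * (q - z (k + l)%N j) = 0.
  rewrite -mulr_sumr sumrB (window_const xT _ kk0) (window_consensus xT j i).
  rewrite -sumrB big_nat big1 ?mulr0// => -[//|l] _.
  by rewrite addnS zi ?subrr// leq_addr.
move: sum0; rewrite big_ltn// => /eqP; rewrite paddr_eq0 ?sumr_ge0//.
by rewrite mulf_eq0 (negbTE q_neq0) subr_eq0 addn1 => /andP[/eqP].
Qed.

Lemma constant_quantization_fixes_x k q :
  (forall i, z k i = q) -> (forall i, z k.+1 i = q) -> x k.+1 =1 x k.+2.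
Proof.
move=> zk zk1 i.
rewrite bq_xS [in RHS]bq_xS bq_alphaS /bq_update_x /bq_update_alpha zk zk1.
under eq_bigr do rewrite zk.
under [in RHS]eq_bigr do rewrite zk1.
by rewrite sumr_const -[_ *+ _]mulr_natl; congr (_ * _); ring.
Qed.

(** Otherwise all nodes are quantized to q, the multipliers are frozen and x is
    constant, so that 1 would be a smaller period. *)
Lemma cycle_leaves_extreme k0 T q i : (2 <= T)%N ->
  cycles_with_period x k0 T -> `|q| = L -> exists2 k, (k0 <= k)%N & z k.+1 i != q.
Proof.
move=> T2 [xT xmin] qL; apply: contrapT => stays.
have zi k : (k0 <= k)%N -> z k.+1 i = q.
  by move=> kk0; apply/eqP/negPn/negP => zNq; apply: stays; exists k.
have zq := window_extreme (ltnW T2) xT qL zi.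
case: (xmin 1%N T2) => k j kk0.
have kT : (k0 <= k + (T - 2))%N by rewrite (leq_trans kk0) ?leq_addr.
(* The times k + T and k + T + 1 are late enough to see constant quantized
   values, as T is at least 2. *)
have := constant_quantization_fixes_x (fun j => zq _ j kT)
  (fun j => zq _ j (leqW kT)) j.
rewrite (xT k j kk0) (xT (k + 1)%N j) ?(leq_trans kk0) ?leq_addr//.
have -> : (k + (T - 2)).+2 = (k + T)%N by lia.
by rewrite addn1 addSn.
Qed.

Lemma period_mul k0 T N k i : period_from x k0 T -> (k0 <= k)%N ->
  x k i = x (k + N * T)%N i.
Proof.
move=> xT kk0; elim: N => [|N ->]; first by rewrite mul0n addn0.
by rewrite xT ?(leq_trans kk0) ?leq_addr// mulSn addnAC addnA.
Qed.

Lemma excursion_bound_le i :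
  4 * rho * d i * L / (1 + 2 * rho * d i)
    <= 4 * rho * n%:R * L / (1 + 2 * rho * n%:R).
Proof.
have rho0 := rho_gt0; have n1 : 0 < 1 + 2 * rho * n%:R.
  by rewrite ltr_wpDr// !mulr_ge0// (ltW rho_gt0).
rewrite ler_pdivrMr ?degree_weight_gt0// [leRHS]mulrAC ler_pdivlMr//.
have : 0 <= 4 * rho * L * (n%:R - d i).
  by rewrite mulr_ge0 ?subr_ge0 ?degree_le// !mulr_ge0// (ltW rho_gt0, ltW L_gt0).
by lra.
Qed.

(** The bounds on the error hold only after the node has left both extremes;
    periodicity carries them back to every time of the cycle. *)
Lemma cycle_error k0 T k i : (2 <= T)%N -> cycles_with_period x k0 T ->
  (k0 <= k)%N ->
  `|x k i - z k i|
    <= Num.max (Delta / 2) (4 * rho * n%:R * L / (1 + 2 * rho * n%:R)).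
Proof.
move=> T2 cyc kk0; have [xT _] := cyc.
have Gamma_le : Num.max (Delta / 2) (4 * rho * d i * L / (1 + 2 * rho * d i))
    <= Num.max (Delta / 2) (4 * rho * n%:R * L / (1 + 2 * rho * n%:R)).
  by rewrite ge_max !le_max lexx excursion_bound_le orbT.
have LE : `|L| = L by rewrite gtr0_norm.
have LNE : `|- L| = L by rewrite normrN.
have [p _ zp] := cycle_leaves_extreme i T2 cyc LE.
have [q _ zq] := cycle_leaves_extreme i T2 cyc LNE.
apply: le_trans Gamma_le; rewrite ler_norml.
rewrite (period_mul (p + q).+2 i xT kk0).
apply/andP; split.
  by apply: (node_error_lower Delta_gt0 rho_gt0 (ler0n _ _) (bq_node_run i) zq); nia.
by apply: (node_error_upper Delta_gt0 rho_gt0 (ler0n _ _) (bq_node_run i) zp); nia.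
Qed.

End Run.

Theorem theorem2 (R : realType) (n : nat) (e : rel 'I_n) (Delta L rho : R)
    (r : 'I_n -> R)
    (n_gt0 : (0 < n)%N) (e_simple : simple_graph e)
    (e_connected : connected_graph e)
    (Delta_gt0 : 0 < Delta) (L_gt0 : 0 < L) (L_lattice : lattice Delta L)
    (rho_gt0 : 0 < rho) :
  let m := #|edges e| in
  let Qb := bounded_quantizer Delta L in
  let x := bq_x e Delta L rho r in
  let rbar := n%:R^-1 * \sum_(i < n) r i in
  let Gamma0 := Num.max (Delta / 2) (4 * rho * n%:R * L / (1 + 2 * rho * n%:R)) in
  exists2 k0 : nat, (0 < k0)%N &
    (exists xQ : R,
       [/\ bounded_lattice Delta L xQ,
           forall (k : nat) (i : 'I_n), (k0 <= k)%N -> Qb (x k i) = xQ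
         & `|xQ - projection L rbar|
             <= (1 + 4 * rho * (m%:R / n%:R)) * (Delta / 2)])
    \/
    (exists (T : nat) (xQ : R),
       [/\ (2 <= T)%N,
           cycles_with_period x k0 T,
           forall (k : nat) (i : 'I_n), (k0 <= k)%N ->
             T%:R^-1 * \sum_(1 <= l < T.+1) Qb (x (k + l)%N i) = xQ
         & `|xQ - rbar| <= (1 + 4 * rho * (m%:R / n%:R)) * Gamma0]).
Proof.
move=> m Qb x rbar Gamma0.
have [k [T0 [T00 xT0]]] := bq_x_eventually_periodic e r Delta_gt0 L_gt0 L_lattice rho_gt0.
have [T T_gt0 cyc] := minimal_period T00 xT0.
have [xT _] := cyc.
pose i0 := Ordinal n_gt0.
exists k.+1 => //; case: (ltnP 1 T) => [T2|T1]; [right | left].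
  exists T, (T%:R^-1 * \sum_(1 <= l < T.+1) Qb (x (k.+1 + l)%N i0)).
  have err l j : (k.+1 < l)%N -> `|x l j - Qb (x l j)| <= Gamma0.
    by move=> kl; apply: cycle_error cyc (ltnW kl).
  split=> // [l i kl|].
    congr (_ * _); rewrite /Qb (window_const xT i kl).
    exact: (window_consensus e_connected rho_gt0 xT).
  rewrite distrC ler_norml; apply/andP; split.
    rewrite lerNl opprB.
    apply: (mean_error_lower e_simple e_connected rho_gt0 _ n_gt0 T_gt0 xT (leqnn _)).
    by move=> l j kl; have := err l j kl; rewrite ler_norml => /andP[]; rewrite lerNl opprB.
  apply: (mean_error_upper e_simple e_connected rho_gt0 _ n_gt0 T_gt0 xT (leqnn _)).
  by move=> l j kl; have := err l j kl; rewrite ler_norml => /andP[].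
have {T1 T_gt0} TE : T = 1%N by apply/eqP; rewrite eqn_leq T1.
subst T; pose xQ := Qb (x k.+2 i0).
have window1 l i : \sum_(1 <= h < 2) Qb (x (l + h)%N i) = Qb (x l.+1 i).
  by rewrite big_nat1 addn1.
have zE l i : (k < l)%N -> Qb (x l i) = xQ.
  move=> kl; have -> : x l i = x l.+1 i by rewrite -addn1; exact: xT.
  rewrite -window1 /Qb (window_const xT i kl).
  rewrite (window_consensus e_connected rho_gt0 xT i i0).
  exact: window1.
have xQE : xQ = 1%:R^-1 * \sum_(1 <= h < 2) Qb (x (k.+1 + h)%N i0).
  by rewrite window1 invr1 mul1r.
have xQ_in : bounded_lattice Delta L xQ by apply: bounded_quantizer_in.
exists xQ; split=> //; apply: projection_dist => //.
- by case: xQ_in.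
- by rewrite !mulr_ge0 ?addr_ge0 ?mulr_ge0 ?invr_ge0 ?ler0n ?ltW.
- case: (eqVneq xQ L) => [|xQNL]; [by left | right]; rewrite xQE.
  apply: (mean_error_upper e_simple e_connected rho_gt0 _ n_gt0 _ xT (leqnn _)) => //.
  move=> l j kl; have zl := zE l j (ltnW kl).
  rewrite -[bq_x e Delta L rho r]/x -/Qb zl.
  have := bounded_quantizer_upper Delta_gt0 L_gt0 L_lattice (x l j).
  by rewrite -/Qb zl => -[/eqP|[_]]; [rewrite (negbTE xQNL) | lra].
- case: (eqVneq xQ (- L)) => [|xQNL]; [by left | right]; rewrite xQE.
  apply: (mean_error_lower e_simple e_connected rho_gt0 _ n_gt0 _ xT (leqnn _)) => //.
  move=> l j kl; have zl := zE l j (ltnW kl).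
  rewrite -[bq_x e Delta L rho r]/x -/Qb zl.
  have := bounded_quantizer_lower Delta_gt0 L_gt0 L_lattice (x l j).
  by rewrite -/Qb zl => -[/eqP|[_]]; [rewrite (negbTE xQNL) | lra].
Qed.
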